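(* Let $(A,d,F)$ be a filtered complex. There is a filtered homotopy transfer diagram consisting of a filtered complex $(M,d,F)$, morphisms of filtered complexes $f:(A,d,F)\to (M,d,F)$ and $g:(M,d,F)\to (A,d,F)$, and a filtered homotopy $h$ from the identity of $A$ to $gf$, where $(M,d,F)$ is such that \[F^pM^n\cong \bigoplus_{q\geq p}E^{q,n-q}_1(A)\text{ and }d(F^pM)\subseteq F^{p+1}M.\] Furthermore, the maps $f$ and $g$ are filtered quasi-isomorphisms.
   Context: All filtered complexes $(A,d,F)$ are cochain complexes over a field $\mathbf{k}$ with bounded below, exhaustive, decreasing filtrations $F^{p+1}A\subseteq F^pA$ satisfying $d(F^pA^n)\subseteq F^pA^{n+1}$. $E_1(A)$ denotes the first page of the spectral sequence associated to the filtration. A morphism of filtered complexes $f$ is a filtered quasi-isomorphism if each restriction $F^pf$ is a quasi-isomorphism. A filtered homotopy from $f$ to $g$ (maps $A\to B$ of filtered complexes) is a map $h:A\to B[-1]$ with $h(F^pA^n)\subseteq F^pB^{n-1}$ and $hd+dh=f-g$. A filtered homotopy transfer diagram between $(A,d,F)$ and $(B,d,F)$ consists of morphisms of filtered complexes $f:A\to B$, $g:B\to A$ and a filtered homotopy $h$ from the identity of $A$ to $gf$. *)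

(* Defs.v *)
From HB Require Import structures.
From mathcomp Require Import all_boot all_algebra generic_quotient.
From mathcomp Require Import boolp.
Set Implicit Arguments. Unset Strict Implicit. Unset Printing Implicit Defensive.
Import GRing.Theory.
Local Open Scope ring_scope.
Local Open Scope quotient_scope.

(* quot Z B := span(Z) / (span(B) restricted to span(Z)) as an lmodType.     *)
(* When Z is a subspace and B a subspace contained in Z, this is Z / B.      *)
Section Span.
Variables (K : fieldType) (V : lmodType K).
Definition subspace (S : V -> Prop) :=
  S 0 /\ forall (a : K) (x y : V), S x -> S y -> S (a *: x + y).
Definition span (S : V -> Prop) (x : V) : Prop :=
  forall T : V -> Prop, subspace T -> (forall y, S y -> T y) -> T x.
Lemma span_subspace S : subspace (span S).
Proof.
split; first by move=> T [T0 _] _.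
move=> a x y Sx Sy T HT ST; case: (HT) => _ TD.
by apply: TD; [apply: Sx | apply: Sy].
Qed.
Lemma span0 S : span S 0. Proof. by case: (span_subspace S) => H _; exact: H. Qed.
Lemma spanD S a x y : span S x -> span S y -> span S (a *: x + y).
Proof. by case: (span_subspace S) => _ H; apply: H. Qed.
Lemma spanZ S a x : span S x -> span S (a *: x).
Proof. by move=> Sx; rewrite -[_ *: _]addr0; apply: spanD => //; apply: span0. Qed.
Lemma spanN S x : span S x -> span S (- x).
Proof. by move=> Sx; rewrite -scaleN1r; apply: spanZ. Qed.
Lemma spanB S x y : span S x -> span S y -> span S (x - y).
Proof. by move=> Sx Sy; rewrite -[x]scale1r; apply: spanD => //; apply: spanN. Qed.
Definition spanb (S : V -> Prop) : {pred V} := fun x => `[< span S x >].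
Lemma spanb_closed S : subsemimod_closed (spanb S).
Proof.
split; first split.
- by apply/asboolP; apply: span0.
- move=> x y /asboolP Sx /asboolP Sy; apply/asboolP.
  by rewrite -[x]scale1r; apply: spanD.
- by move=> a x /asboolP Sx; apply/asboolP; apply: spanZ.
Qed.
HB.instance Definition _ S := GRing.isSubmodClosed.Build K V (spanb S) (spanb_closed S).
End Span.

Section Quot.
Variables (K : fieldType) (V : lmodType K) (Z B : V -> Prop).
Inductive cyc : predArgType := Cyc (x : V) of x \in spanb Z.
Definition cycval (w : cyc) : V := let: Cyc x _ := w in x.
HB.instance Definition _ := [isSub of cyc for cycval].
HB.instance Definition _ := [Choice of cyc by <:].
HB.instance Definition _ := [SubChoice_isSubZmodule of cyc by <:].
HB.instance Definition _ := [SubZmodule_isSubLmodule of cyc by <:].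

Local Notation SB := (spanb B).
Definition qequiv (x y : cyc) := (val x - val y) \in SB.
Lemma qequivE0 x y : qequiv x y = (val x - val y \in SB). Proof. by []. Qed.
Lemma qequiv_is_equiv : equiv_class_of qequiv.
Proof.
split=> [x|x y|y x z]; rewrite !qequivE0 ?subrr ?rpred0 //.
   by rewrite -opprB rpredN.
by move=> *; rewrite -[val x](addrNK (val y)) -addrA rpredD.
Qed.
Canonical qequiv_equiv := EquivRelPack qequiv_is_equiv.
Canonical qequiv_encModRel := defaultEncModRel qequiv.
Definition quot := {eq_quot qequiv}.
HB.instance Definition _ : EqQuotient cyc qequiv quot := EqQuotient.on quot.
HB.instance Definition _ := Choice.on quot.

Lemma qBE x y : (val x - val y) \in SB = (x == y %[mod quot]).
Proof. by rewrite piE qequivE0. Qed.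
Lemma qDE x y : (val x + val y) \in SB = (x == - y %[mod quot]).
Proof. by rewrite -qBE /= opprK. Qed.

Definition qzero : quot := lift_cst quot 0.
Definition qadd := lift_op2 quot +%R.
Definition qopp := lift_op1 quot -%R.
Definition qscale (a : K) := lift_op1 quot ( *:%R a).
Canonical pi_qzero_morph := PiConst qzero.

Lemma pi_qopp : {morph \pi : x / - x >-> qopp x}.
Proof.
move=> x; unlock qopp; apply/eqP; rewrite piE qequivE0 /=.
by rewrite opprK addrC -opprB rpredN qBE reprK.
Qed.
Canonical pi_qopp_morph := PiMorph1 pi_qopp.

Lemma pi_qadd : {morph \pi : x y / x + y >-> qadd x y}.
Proof.
move=> x y /=; unlock qadd; apply/eqP; rewrite piE qequivE0 /=.
rewrite opprD addrAC addrA -addrA.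
apply: rpredD; first by rewrite qBE reprK.
by rewrite addrC qBE reprK.
Qed.
Canonical pi_qadd_morph := PiMorph2 pi_qadd.

Lemma pi_qscale a : {morph \pi : x / a *: x >-> qscale a x}.
Proof.
move=> x /=; unlock qscale; apply/eqP; rewrite piE qequivE0 /=.
by rewrite -scalerBr rpredZ // qBE reprK.
Qed.

Lemma qaddA: associative qadd.
Proof. by move=> x y z; rewrite -[x]reprK -[y]reprK -[z]reprK !piE addrA. Qed.
Lemma qaddC: commutative qadd.
Proof. by move=> x y; rewrite -[x]reprK -[y]reprK !piE addrC. Qed.
Lemma qadd0: left_id qzero qadd.
Proof. by move=> x; rewrite -[x]reprK !piE add0r. Qed.
Lemma qaddN: left_inverse qzero qopp qadd.
Proof. by move=> x; rewrite -[x]reprK !piE addNr. Qed.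
HB.instance Definition _ := GRing.isZmodule.Build quot qaddA qaddC qadd0 qaddN.

Lemma qscaleA a b v : qscale a (qscale b v) = qscale (a * b) v.
Proof. by rewrite -[v]reprK -!pi_qscale scalerA. Qed.
Lemma qscale1 : left_id 1 qscale.
Proof. by move=> v; rewrite -[v]reprK -!pi_qscale scale1r. Qed.
Lemma qscaleDr : right_distributive qscale +%R.
Proof.
move=> a u v; rewrite -[u]reprK -[v]reprK /GRing.add /=.
by rewrite -pi_qadd -!pi_qscale -pi_qadd scalerDr.
Qed.
Lemma qscaleDl v : {morph qscale^~ v: a b / a + b}.
Proof.
move=> a b; rewrite -[v]reprK /GRing.add /=.
by rewrite -!pi_qscale -pi_qadd scalerDl.
Qed.
HB.instance Definition _ :=
  GRing.Zmodule_isLmodule.Build K quot qscaleA qscale1 qscaleDr qscaleDl.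
End Quot.

Arguments quot {K V} Z B.

(* The map induced on quotients by phi : V -> W (meaningful when phi maps Z
   into Z' and B into B'): the class of x goes to the class of phi x. *)
Definition qmap (K : fieldType) (V W : lmodType K) (Z B : V -> Prop)
  (Z' B' : W -> Prop) (phi : V -> W) (c : quot Z B) : quot Z' B' :=
  \pi_(quot Z' B') (insubd (0 : cyc Z') (phi (val (repr c)))).

(* Degrees are in int.  A graded map of degree k is encoded as a family      *)
(* u n m : A^n -> B^m, required to vanish unless m = n + k; this avoids      *)
(* dependent casts between A^(n-1+1) and A^n.                                *)
Record fcdata (K : fieldType) := FCData {
  fc_obj : int -> lmodType K;
  fc_d : forall n m : int, {linear fc_obj n -> fc_obj m};
  fc_F : int -> forall n : int, fc_obj n -> Prop
}.
Arguments fc_obj {K}.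
Arguments fc_d {K}.
Arguments fc_F {K}.

Section Filtered.
Variable K : fieldType.

Definition filtered_complex (A : fcdata K) : Prop :=
  (forall n m x, m != n + 1 -> fc_d A n m x = 0) /\
  (forall n x, fc_d A (n + 1) (n + 1 + 1) (fc_d A n (n + 1) x) = 0) /\
  (forall p n, subspace (fc_F A p n)) /\
  (forall p n x, fc_F A (p + 1) n x -> fc_F A p n x) /\
  (forall p n x, fc_F A p n x -> fc_F A p (n + 1) (fc_d A n (n + 1) x)) /\
  (forall n x, exists p, fc_F A p n x) /\
  (forall n, exists p, forall x, fc_F A p n x -> x = 0).

Definition fmorphism (A B : fcdata K)
    (f : forall n, {linear fc_obj A n -> fc_obj B n}) : Prop :=
  (forall n x, f (n + 1) (fc_d A n (n + 1) x) = fc_d B n (n + 1) (f n x)) /\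
  (forall p n x, fc_F A p n x -> fc_F B p n (f n x)).

Definition fhomotopy (A B : fcdata K)
    (h : forall n m, {linear fc_obj A n -> fc_obj B m})
    (f1 f2 : forall n, fc_obj A n -> fc_obj B n) : Prop :=
  [/\ (forall n m x, m != n - 1 -> h n m x = 0),
      (forall p n x, fc_F A p n x -> fc_F B p (n - 1) (h n (n - 1) x)) &
      (forall n x, h (n + 1) n (fc_d A n (n + 1) x)
                   + fc_d B (n - 1) n (h n (n - 1) x) = f1 n x - f2 n x)].

#[local] Unset Implicit Arguments.
Definition cocycF (A : fcdata K) p n (x : fc_obj A n) : Prop :=
  fc_F A p n x /\ fc_d A n (n + 1) x = 0.
#[local] Set Implicit Arguments.
#[local] Unset Implicit Arguments.
Definition cobdyF (A : fcdata K) p n (x : fc_obj A n) : Prop :=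
  exists y, fc_F A p (n - 1) y /\ x = fc_d A (n - 1) n y.
#[local] Set Implicit Arguments.
Definition HF (A : fcdata K) (p n : int) : lmodType K :=
  quot (cocycF A p n) (cobdyF A p n).

#[local] Unset Implicit Arguments.
Definition HFmap {A B : fcdata K} (f : forall n, {linear fc_obj A n -> fc_obj B n})
    (p n : int) : HF A p n -> HF B p n :=
  qmap (cocycF B p n) (cobdyF B p n) (f n).
#[local] Set Implicit Arguments.

Definition filtered_qiso (A B : fcdata K)
    (f : forall n, {linear fc_obj A n -> fc_obj B n}) : Prop :=
  forall p n, bijective (HFmap f p n).

(* E_1^{p,q}(A) = H^{p+q}(F^p A / F^(p+1) A)
               = {x in F^p A^(p+q) | dx in F^(p+1)} / (F^(p+1) A^(p+q) + d F^p A^(p+q-1)) *)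
#[local] Unset Implicit Arguments.
Definition E1Z (A : fcdata K) p n (x : fc_obj A n) : Prop :=
  fc_F A p n x /\ fc_F A (p + 1) (n + 1) (fc_d A n (n + 1) x).
#[local] Set Implicit Arguments.
#[local] Unset Implicit Arguments.
Definition E1B (A : fcdata K) p n (x : fc_obj A n) : Prop :=
  fc_F A (p + 1) n x \/ exists y, fc_F A p (n - 1) y /\ x = fc_d A (n - 1) n y.
#[local] Set Implicit Arguments.
Definition E1 (A : fcdata K) (p q : int) : lmodType K :=
  quot (E1Z A p (p + q)) (E1B A p (p + q)).

(* The subspace S of W is isomorphic to the direct sum of the family
   (E q)_(q >= p): there are linear maps iota q : E q -> W such that the
   induced map from the direct sum, (e_q)_q |-> sum_q iota q (e_q), is
   injective and has image exactly S. *)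
Definition iso_dsum (W : lmodType K) (S : W -> Prop) (p : int)
    (E : int -> lmodType K) : Prop :=
  exists iota : forall q, {linear E q -> W},
    (forall (s : seq int) (e : forall q, E q),
       uniq s -> all (fun q => p <= q) s ->
       \sum_(q <- s) iota q (e q) = 0 -> forall q, q \in s -> e q = 0) /\
    (forall w, S w <-> exists (s : seq int) (e : forall q, E q),
       all (fun q => p <= q) s /\ w = \sum_(q <- s) iota q (e q)).

End Filtered.

(* Main.v *)
Require Import Defs.
From HB Require Import structures.
From mathcomp Require Import all_boot all_algebra.
From mathcomp Require Import all_order generic_quotient boolp classical_sets zify.
Import Order.TTheory GRing.Theory.
Local Open Scope ring_scope.
Set Implicit Arguments.
Unset Strict Implicit.
Unset Printing Implicit Defensive.

(** Choose in each degree a maximal subspace [L] of [A] on which [d] is strict: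
    for [x] in [L], [d x] in [F^p] forces [x] in [F^p].  Maximality makes [L] a
    lift of a complement of the cocycles of Gr [A].  The map sending
    [l + d l'] to [l'] on [L + d L] is well defined and filtered, and extends to
    a filtered map [h] of degree -1 with values in [L]; it satisfies [h h = 0]
    and [h d h = h], so that [phi = d h + h d] is an idempotent morphism of
    filtered complexes.  Its kernel [M] is a filtered retract of [A] with
    homotopy [h].  If [x] lies in [F^p M] and [x - l] is a cocycle of Gr [A],
    then [h d x = 0] gives [l = - h d (x - l)] in [F^(p+1)], so [d] vanishes on
    Gr [M], and Gr [M] is isomorphic to [E_1(A)]. *)

(** * Subspaces and maximal extensions *)

Section Subspaces.
Variables (K : fieldType) (V : lmodType K).
Implicit Types S : V -> Prop.

Lemma subspace0 S : subspace S -> S 0.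
Proof. by case. Qed.

Lemma subspaceZ S a x : subspace S -> S x -> S (a *: x).
Proof. by case=> S0 SD Sx; rewrite -[_ *: _]addr0; apply: SD. Qed.

Lemma subspaceD S x y : subspace S -> S x -> S y -> S (x + y).
Proof. by case=> _ SD Sx Sy; rewrite -[x]scale1r; apply: SD. Qed.

Lemma subspaceN S x : subspace S -> S x -> S (- x).
Proof. by move=> Ss Sx; rewrite -scaleN1r; apply: subspaceZ. Qed.

Lemma subspaceB S x y : subspace S -> S x -> S y -> S (x - y).
Proof. by move=> Ss Sx Sy; apply: subspaceD => //; apply: subspaceN. Qed.

Lemma subspace_addKl S x y : subspace S -> S x -> S (x + y) -> S y.
Proof. by move=> Ss Sx Sxy; rewrite -(addKr x y) addrC; apply: subspaceB. Qed.

Lemma subspace_sum S (I : eqType) (r : seq I) (F : I -> V) :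
  subspace S -> (forall i, i \in r -> S (F i)) -> S (\sum_(i <- r) F i).
Proof.
move=> Ss SF; rewrite big_seq; apply: big_ind => //; first exact: subspace0.
by move=> x y; apply: subspaceD.
Qed.

Lemma subspace_zero : subspace (fun x : V => x = 0).
Proof. by split=> // a x y -> ->; rewrite scaler0 addr0. Qed.

Lemma spanE S x : subspace S -> Defs.span S x <-> S x.
Proof. by move=> Ss; split=> [|Sx T _]; apply. Qed.

(* Zorn_bigcup also asks for the empty chain, hence a maximal [S `|` S0]
   instead of a maximal [S] above [S0]. *)
Lemma maximal_subspace_in (good S0 : V -> Prop) :
  subspace S0 -> (forall x, S0 x -> good x) ->
  exists S, [/\ subspace S, forall x, S0 x -> S x, forall x, S x -> good x &
    forall x, (forall a y, S y -> good (a *: x + y)) -> S x].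
Proof.
move=> sub0 good0; pose U (S : set V) x := S0 x \/ S x.
pose P := [set S | subspace (U S) /\ forall x, U S x -> good x]%classic.
have [F FP Ftot|S [[SsU gU] maxS]] := @Zorn_bigcup V P.
  have UF X x : F X -> U X x -> U (\bigcup_(Y in F) Y)%classic x.
    by move=> FX [|]; [left | right; exists X].
  split; last first.
    by move=> x [|[X FX Xx]]; [exact: good0 | apply: (FP X FX).2; right].
  split; first by left; apply: subspace0.
  have UX X a x y : F X -> U X x -> U X y ->
      U (\bigcup_(Y in F) Y)%classic (a *: x + y).
    by move=> FX Xx Xy; apply: (UF X) => //; apply: (FP X FX).1.2.
  move=> a x y [S0x|[X FX Xx]] [S0y|[Y FY Yy]].
  - by left; apply: sub0.2.
  - by apply: (UX Y); [|left|right].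
  - by apply: (UX X); [|right|left].
  - have [XY|YX] := Ftot _ _ FX FY.
      by apply: (UX Y); [|right; apply: XY|right].
    by apply: (UX X); [|right|right; apply: YX].
exists (U S); split=> //; first by left.
move=> x gx; apply: contrapT => Ux.
(* [T] is the sum of [U S] and the line through [x]. It contains [S0], so [U T] is [T] itself, and
   maximality of [S] then puts [x] in [S]. *)
pose T := [set z | exists a y, U S y /\ z = a *: x + y]%classic.
have ST : (S `<=` T)%classic.
  by move=> z Sz; exists 0, z; split; [right | rewrite scale0r add0r].
have UT z : U T z -> T z.
  case=> // S0z; exists 0, z; split; [by left | by rewrite scale0r add0r].
apply: (maxS T).
  split=> // TS; apply: Ux; right; apply: TS; exists 1, 0.
  by split; [apply: subspace0 | rewrite scale1r addr0].
split; last by move=> z /UT [a [y [Uy ->]]]; apply: gx.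
split; first by left; apply: subspace0.
move=> b z w /UT [a [y [Uy ->]]] /UT [a' [y' [Uy' ->]]].
right; exists (b * a + a'), (b *: y + y'); split; first exact: SsU.2.
by rewrite scalerDr scalerA scalerDl addrACA.
Qed.

End Subspaces.

(** * Linear maps obtained from their graphs *)

Section LinearRelations.
Variables (K : fieldType) (V W : lmodType K).

(** Two values over the same [x] differ by a value over 0, so [G] is the graph of a function, which
    is linear because [G] is a subspace. *)
Lemma linear_of_relation (G : V * W -> Prop) :
  subspace G -> (forall y, G (0, y) -> y = 0) -> (forall x, exists y, G (x, y)) ->
  exists u : {linear V -> W}, forall x y, G (x, y) <-> y = u x.
Proof.
move=> Gs G1 /choice [u Gu].
have uP x y : G (x, y) <-> y = u x.
  split=> [Gxy|->//]; apply/eqP; rewrite -subr_eq0; apply/eqP/G1.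
  have -> : (0, y - u x) = (x, y) - (x, u x) by congr (_, _); rewrite /= subrr.
  exact: subspaceB.
have u_lin : linear u.
  by move=> a x y; apply/esym/uP; apply: (Gs.2 a (x, u x) (y, u y)).
pose uL := GRing.isLinear.Build K V W _ u u_lin.
by exists (HB.pack_for {linear V -> W} u uL).
Qed.

(** A maximal single-valued subspace of [G] is the graph of a total map, so values can be selected
    linearly without choosing a basis. *)
Lemma linear_section (G : V * W -> Prop) :
  subspace G -> (forall x, exists y, G (x, y)) ->
  exists u : {linear V -> W}, forall x, G (x, u x).
Proof.
move=> Gs Gtot; pose good (z : V * W) := G z /\ (z.1 = 0 -> z.2 = 0).
have [|z ->|S [Ss _ Sgood Smax]] :=
    @maximal_subspace_in K (V * W)%type good (fun z => z = 0).
- exact: subspace_zero.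
- by split=> //; apply: subspace0.
have [|x|u uP] := @linear_of_relation S Ss.
- by move=> y /Sgood [_ /(_ erefl)].
- apply: contrapT => nSx; have [y Gxy] := Gtot x; case: (nSx); exists y.
  apply: Smax => a [x' y'] Sxy'; split; first exact: (Gs.2 a _ _ Gxy (Sgood _ Sxy').1).
  move=> /= ax; have [a0|a0] := eqVneq a 0.
    move: ax; rewrite a0 !scale0r !add0r => x0.
    exact: (Sgood _ Sxy').2.
  (* For nonzero [a], the relation [a *: x + x' = 0] shows that [x] is already in the domain of
     [S]. *)
  case: nSx; exists (- a^-1 *: y').
  suff -> : (x, - a^-1 *: y') = - a^-1 *: (x', y') by apply: subspaceZ.
  congr (_, _); rewrite /= -[x' in RHS](addKr (a *: x)) ax addr0.
  by rewrite scaleNr scalerN opprK scalerA mulVf // scale1r.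
by exists u => x; apply: (Sgood _ _).1; apply/uP.
Qed.

End LinearRelations.

(** * Quotients of subspaces and induced maps *)

Section Quotients.
Variable K : fieldType.
Local Open Scope quotient_scope.

(** Cycles and quotients are built from spans so as to make sense for any predicate; for a subspace
    the span changes nothing. *)
Lemma mem_spanb (V : lmodType K) (S : V -> Prop) x :
  subspace S -> (x \in spanb S) <-> S x.
Proof.
by move=> Ss; split=> [/asboolP/(spanE _ Ss)|/(spanE _ Ss) Sx] //; apply/asboolP.
Qed.

Lemma cycP (V : lmodType K) (Z : V -> Prop) (z : cyc Z) : subspace Z -> Z (val z).
Proof. by move=> Zs; apply/(mem_spanb _ Zs); apply: valP. Qed.

Lemma cyc_of (V : lmodType K) (Z : V -> Prop) x :
  subspace Z -> Z x -> exists z : cyc Z, val z = x.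
Proof. by move=> Zs /(mem_spanb _ Zs) Zx; exists (Cyc Zx). Qed.

Lemma corestrict_linear (V W : lmodType K) (Z : W -> Prop) (u : {linear V -> W}) :
  subspace Z -> (forall x, Z (u x)) ->
  exists v : {linear V -> cyc Z}, forall x, val (v x) = u x.
Proof.
move=> Zs uZ; have [v vE] := choice (fun x => cyc_of Zs (uZ x)).
have v_lin : linear v by move=> a x y; apply: val_inj; rewrite linearP /= !vE linearP.
pose vL := GRing.isLinear.Build K V (cyc Z) _ v v_lin.
by exists (HB.pack_for {linear V -> cyc Z} v vL).
Qed.

Lemma quotP (V : lmodType K) (Z B : V -> Prop) (c : quot Z B) :
  exists z : cyc Z, c = \pi_(quot Z B) z.
Proof. by exists (repr c); rewrite reprK. Qed.

Lemma eq_quotP (V : lmodType K) (Z B : V -> Prop) (z w : cyc Z) :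
  \pi_(quot Z B) z = \pi_(quot Z B) w <-> Defs.span B (val z - val w).
Proof.
split=> [/eqP|Bzw]; first by rewrite -qBE => /asboolP.
by apply/eqP; rewrite -qBE; apply/asboolP.
Qed.

Lemma pi_quot_linear (V : lmodType K) (Z B : V -> Prop) a (z w : cyc Z) :
  \pi_(quot Z B) (a *: z + w) = a *: \pi_(quot Z B) z + \pi_(quot Z B) w.
Proof. by rewrite pi_qadd pi_qscale. Qed.

Lemma pi_quot0 (V : lmodType K) (Z B : V -> Prop) : \pi_(quot Z B) 0 = 0.
Proof.
have := pi_quot_linear B (-1) (0 : cyc Z) 0.
by rewrite scaler0 addr0 scaleN1r addNr.
Qed.

(** [qmap] is computed on a chosen representative. Another choice moves the image by [u] of an
    element of [B], hence by an element of [B'], so any representative may be used. *)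
Lemma qmap_pi (V W : lmodType K) (Z B : V -> Prop) (Z' B' : W -> Prop)
    (u : {linear V -> W}) (z : cyc Z) (w : cyc Z') :
  subspace Z -> subspace B -> subspace Z' -> subspace B' ->
  (forall x, Z x -> Z' (u x)) -> (forall x, B x -> B' (u x)) ->
  val w = u (val z) ->
  qmap Z' B' u (\pi_(quot Z B) z) = \pi_(quot Z' B') w.
Proof.
move=> Zs Bs Z's B's uZ uB wE; apply/eq_quotP/(spanE _ B's); rewrite insubdK.
  rewrite wE -linearB; apply: uB; apply/(spanE _ Bs)/eq_quotP.
  by rewrite reprK.
suff: u (val (repr (\pi_(quot Z B) z))) \in spanb Z' by [].
by apply/(mem_spanb _ Z's)/uZ; apply: cycP.
Qed.

End Quotients.

(** The last two hypotheses make [u] and [v] inverse to each other modulo [B] and [B'], so the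
    inverse is the map induced by [v]. *)
Lemma qmap_bijective (K : fieldType) (V W : lmodType K)
    (Z B : V -> Prop) (Z' B' : W -> Prop)
    (u : {linear V -> W}) (v : {linear W -> V}) :
  subspace Z -> subspace B -> subspace Z' -> subspace B' ->
  (forall x, Z x -> Z' (u x)) -> (forall x, B x -> B' (u x)) ->
  (forall y, Z' y -> Z (v y)) -> (forall y, B' y -> B (v y)) ->
  (forall x, Z x -> B (v (u x) - x)) -> (forall y, Z' y -> B' (u (v y) - y)) ->
  bijective (qmap Z' B' u : quot Z B -> quot Z' B').
Proof.
move=> Zs Bs Z's B's uZ uB vZ vB vu uv; exists (qmap Z B v) => c.
  have [z ->] := quotP c; have Zz := cycP z Zs.
  have [w wE] := cyc_of Z's (uZ _ Zz); have [t tE] := cyc_of Zs (vZ _ (uZ _ Zz)).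
  rewrite (qmap_pi (u := u) (z := z) (w := w)) //.
  rewrite (qmap_pi (u := v) (z := w) (w := t)) ?wE //.
  by apply/eq_quotP/(spanE _ Bs); rewrite tE; apply: vu.
have [z ->] := quotP c; have Zz := cycP z Z's.
have [w wE] := cyc_of Zs (vZ _ Zz); have [t tE] := cyc_of Z's (uZ _ (vZ _ Zz)).
rewrite (qmap_pi (u := v) (z := z) (w := w)) //.
rewrite (qmap_pi (u := u) (z := w) (w := t)) ?wE //.
by apply/eq_quotP/(spanE _ B's); rewrite tE; apply: uv.
Qed.

(** * Filtered vector spaces *)

Section Filtrations.
Variable K : fieldType.

Definition filtration (V : lmodType K) (F : int -> V -> Prop) : Prop :=
  [/\ forall p, subspace (F p), forall p x, F (p + 1) x -> F p x,
      forall x, exists p, F p x & exists p, forall x, F p x -> x = 0].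

Lemma filtration_le (V : lmodType K) (F : int -> V -> Prop) p q x :
  filtration F -> p <= q -> F q x -> F p x.
Proof.
move=> [_ Fdec _ _] le_pq; have -> : q = p + `|q - p|%N%:Z by lia.
elim: `|q - p|%N => [|k IHk]; first by rewrite addr0.
by move=> Fx; apply/IHk/Fdec; rewrite -addrA; move: Fx; congr F; lia.
Qed.

(** Passing to ever deeper elements of [Q] stops before level [P], where only 0 is left. The
    induction is on a bound [k] for the remaining distance to [P]. *)
Lemma filtration_deepest (V : lmodType K) (F : int -> V -> Prop) (Q : V -> Prop) :
  filtration F -> (exists x, Q x) -> ~ Q 0 ->
  exists p x, [/\ Q x, F p x & forall q y, Q y -> F q y -> q <= p].
Proof.
move=> FF [x0 Qx0] nQ0; have [_ _ Fex [P FP]] := FF.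
have [p0 Fx0] := Fex x0.
have [k le_P] : exists k : nat, P <= p0 + k%:Z by exists `|P - p0|%N; lia.
elim: k p0 x0 Qx0 Fx0 le_P => [|k IHk] p x Qx Fx le_P.
  suff x0 : x = 0 by case: nQ0; rewrite -x0.
  by apply/FP/(filtration_le FF _ Fx); lia.
have [[y [Qy Fy]]|nQ] := pselect (exists y, Q y /\ F (p + 1) y).
  by apply: (IHk (p + 1) y) => //; lia.
exists p, x; split=> // q y Qy Fy; rewrite leNgt; apply/negP => lt_pq.
by apply: nQ; exists y; split=> //; apply: (filtration_le FF _ Fy); lia.
Qed.

(** A maximal filtered relation containing [R], with values in [L], is the graph of a total map.
    Being filtered makes it single-valued: 0 lies in every [F q], so its values lie in [G P], which
    is zero. *)
Lemma filtered_extension (V W : lmodType K) (F : int -> V -> Prop)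
    (G : int -> W -> Prop) (L : W -> Prop) (R : V * W -> Prop) :
  filtration F -> filtration G -> subspace L -> subspace R ->
  (forall x y, R (x, y) -> L y /\ forall q, F q x -> G q y) ->
  exists u : {linear V -> W},
    [/\ forall x y, R (x, y) -> u x = y, forall x, L (u x) &
        forall q x, F q x -> G q (u x)].
Proof.
move=> FF GG Ls Rs Rfilt; have [Fs _ _ _] := FF; have [Gs _ _ [P GP]] := GG.
pose good (z : V * W) := L z.2 /\ forall q, F q z.1 -> G q z.2.
have [|S [Ss RS Sgood Smax]] := @maximal_subspace_in K (V * W)%type good R Rs.
  by case.
have [y|x|u uP] := linear_of_relation Ss.
- by move=> /Sgood [_ /(_ P)] /= H; apply/GP/H; apply: subspace0.
- apply: contrapT => nSx.
  (* The new vector is chosen as deep as possible in its coset modulo the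
     domain of S; then sending it to 0 cannot break the filtration. *)
  have [||p [z [[k [y [Sky ->]]] Fz zmax]]] := filtration_deepest
      (Q := fun z => exists k y, S (k, y) /\ z = x + k) FF.
  + by exists (x + 0), 0, 0; split=> //; apply: Ss.1.
  + move=> [k [y [Sky /eqP]]]; rewrite eq_sym addr_eq0 => /eqP xE.
    apply: nSx; exists (- y); rewrite xE.
    exact: (subspaceN Ss Sky).
  suff Sz : S (x + k, 0).
    apply: nSx; exists (- y).
    have -> : (x, - y) = (x + k, 0) - (k, y).
      by congr (_, _); rewrite /= ?addrK ?sub0r.
    exact: subspaceB.
  apply: Smax => a [k' y'] Sky'; have [Ly' Fy'] := Sgood _ Sky'.
  rewrite /good /= scaler0 add0r; split=> // q.
  have [->|a0] := eqVneq a 0; first by rewrite scale0r add0r; apply: Fy'.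
  move=> Fq; apply: Fy' => /=.
  (* Divided by [a], the element lies in the coset of [x], so it is no deeper than [p]. Hence
     [x + k] is in [F q], and so is [k']. *)
  have le_qp : q <= p.
    apply: (zmax q (a^-1 *: (a *: (x + k) + k'))); last exact: subspaceZ.
    exists (k + a^-1 *: k'), (y + a^-1 *: y'); split.
      by apply: (subspaceD Ss Sky (subspaceZ a^-1 Ss Sky')).
    by rewrite scalerDr scalerA mulVf // scale1r addrA.
  apply: (subspace_addKl (Fs q) _ Fq).
  by apply: subspaceZ => //; apply: (filtration_le FF le_qp).
exists u; split=> [x y /RS/uP ->//|x|q x].
  by have [] := Sgood (x, u x) ((uP _ _).2 erefl).
by have [_] := Sgood (x, u x) ((uP _ _).2 erefl); apply.
Qed.

(** The hypotheses say that [iota q] identifies [E q] with the quotient of [F q] by [F (q + 1)]. In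
    a vanishing sum the components die from the smallest index on, the later terms being in
    [F (q + 1)]; an element is decomposed by removing leading terms until the remainder lies in
    [F P], which is zero. *)
Lemma iso_dsum_filtration (W : lmodType K) (F : int -> W -> Prop)
    (E : int -> lmodType K) (iota : forall q, {linear E q -> W}) :
  filtration F ->
  (forall q e, F q (iota q e)) ->
  (forall q e, F (q + 1) (iota q e) -> e = 0) ->
  (forall q x, F q x -> exists e, F (q + 1) (x - iota q e)) ->
  forall p, iso_dsum (F p) p E.
Proof.
move=> FF iotaF iota_inj iota_surj p; have [Fs _ _ [P FP]] := FF.
exists iota; split=> [s e us ps sum0 q qs|x].
  have [k lt_q] : exists k : nat, q < p + k%:Z by exists `|q - p|%N.+1; lia.
  elim: k q qs lt_q => [|k IHk] q qs lt_q; first by have := allP ps _ qs; lia.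
  apply: iota_inj; have/eqP := sum0; rewrite (bigD1_seq q) //= addr_eq0 => /eqP ->.
  apply: subspaceN => //; rewrite -big_filter; apply: subspace_sum => // r.
  rewrite mem_filter => /andP[rq rs]; have [lt_rq|le_qr] := ltP r q.
    by rewrite IHk ?linear0 //; [apply: subspace0 | lia].
  by apply: (filtration_le FF _ (iotaF r _)); lia.
split=> [|[s [e [ps ->]]]]; last first.
  by apply: subspace_sum => // q /(allP ps) le_pq; apply: (filtration_le FF le_pq).
have [k le_P] : exists k : nat, P <= p + k%:Z by exists `|P - p|%N; lia.
elim: k p x le_P => [|k IHk] p x le_P Fx.
  exists [::], (fun=> 0); rewrite big_nil; split=> //.
  by apply/FP/(filtration_le FF _ Fx); lia.
have [e0 /IHk [|s [e [ps xE]]]] := iota_surj p x Fx; first by lia.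
(* [dfwith e e0] is [e] with its value at [p] replaced by [e0]; the indices in [s] exceed [p], so
   their terms are unchanged. *)
exists (p :: s), (dfwith e e0); split=> /=.
  by rewrite lexx; apply: sub_all ps => q; lia.
rewrite big_cons dfwith_in -[x in LHS](subrK (iota p e0)) addrC xE.
congr (_ + _); apply: eq_big_seq => q qs; rewrite dfwith_out //.
by have := allP ps _ qs; lia.
Qed.

End Filtrations.

(** * Filtered complexes, retracts and the contraction [h] *)

Section FilteredComplexes.
Variable K : fieldType.
Implicit Types A B : fcdata K.

Lemma fc_filtration A n : filtered_complex A -> filtration (fun p => fc_F A p n).
Proof.
case=> _ [_ [Fs [Fdec [_ [Fex Fbd]]]]]; split=> [p|p x|x|] //.
exact: Fdec.
Qed.

Lemma fc_d_eq0 A n m x : filtered_complex A -> m != n + 1 -> fc_d A n m x = 0.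
Proof. by case=> d0 _; apply: d0. Qed.

Lemma fc_dd A n m k x : filtered_complex A -> fc_d A m k (fc_d A n m x) = 0.
Proof.
move=> HA; have [_ [dd _]] := HA.
have [mE|/fc_d_eq0->] := eqVneq m (n + 1); rewrite ?linear0 //.
have [kE|/fc_d_eq0->] := eqVneq k (m + 1); rewrite ?linear0 //.
by subst m k; apply: dd.
Qed.

Lemma fc_F_d A p n m x :
  filtered_complex A -> fc_F A p n x -> fc_F A p m (fc_d A n m x).
Proof.
move=> HA Fx; have [_ [_ [Fs [_ [Fd _]]]]] := HA.
have [->|/fc_d_eq0->] := eqVneq m (n + 1); rewrite //; first exact: Fd.
exact: subspace0.
Qed.

Lemma fmorphism_d A B (f : forall n, {linear fc_obj A n -> fc_obj B n}) n m x :
  fmorphism f -> m = n + 1 -> f m (fc_d A n m x) = fc_d B n m (f n x).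
Proof. by move=> [fd _] ->; apply: fd. Qed.

Lemma cocycF_subspace A p n : filtered_complex A -> subspace (cocycF K A p n).
Proof.
case=> _ [_ [Fs _]]; split; first by split; [apply: subspace0 | rewrite linear0].
move=> a x y [Fx dx] [Fy dy]; split; first exact: (Fs p n).2.
by rewrite linearP dx dy scaler0 addr0.
Qed.

Lemma cobdyF_subspace A p n : filtered_complex A -> subspace (cobdyF K A p n).
Proof.
case=> _ [_ [Fs _]]; split; first by exists 0; rewrite linear0; split=> //; apply: subspace0.
move=> a _ _ [x [Fx ->]] [y [Fy ->]]; exists (a *: x + y).
by split; [exact: (Fs p (n - 1)).2 | rewrite linearP].
Qed.

Lemma fmorphism_cocycF A B (f : forall n, {linear fc_obj A n -> fc_obj B n}) p n x :
  fmorphism f -> cocycF K A p n x -> cocycF K B p n (f n x).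
Proof.
move=> ff [Fx dx]; split; first exact: ff.2.
by rewrite -(fmorphism_d _ ff) // dx linear0.
Qed.

Lemma fmorphism_cobdyF A B (f : forall n, {linear fc_obj A n -> fc_obj B n}) p n x :
  fmorphism f -> cobdyF K A p n x -> cobdyF K B p n (f n x).
Proof.
move=> ff [y [Fy ->]]; exists (f (n - 1) y); split; first exact: ff.2.
by rewrite (fmorphism_d _ ff) //; lia.
Qed.

(** On a cocycle of $F^p$, $gf - 1 = -(hd + dh) = -dh$ takes values in $d(F^p)$, while $fg = 1$
    holds exactly. *)
Lemma filtered_qiso_of_retract A B
    (f : forall n, {linear fc_obj A n -> fc_obj B n})
    (g : forall n, {linear fc_obj B n -> fc_obj A n})
    (h : forall n m, {linear fc_obj A n -> fc_obj A m}) :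
  filtered_complex A -> filtered_complex B -> fmorphism f -> fmorphism g ->
  fhomotopy h (fun n x => x) (fun n x => g n (f n x)) ->
  (forall n y, f n (g n y) = y) -> filtered_qiso f /\ filtered_qiso g.
Proof.
move=> HA HB ff fg [_ hF hE] fgK.
have gf p n x : cocycF K A p n x -> cobdyF K A p n (g n (f n x) - x).
  move=> [Fx dx]; exists (- h n (n - 1) x); split.
    by apply: subspaceN; [case: HA => _ [_ [Fs _]] | apply: hF].
  by rewrite linearN -opprB -hE dx linear0 add0r.
have gfB p n y : cocycF K B p n y -> cobdyF K B p n (f n (g n y) - y).
  by move=> _; rewrite fgK subrr; apply: subspace0; apply: cobdyF_subspace.
by split=> p n; [apply: (qmap_bijective (v := g n)) | apply: (qmap_bijective (v := f n))];
  (try exact: cocycF_subspace); (try exact: cobdyF_subspace) => x;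
  do ?[exact: fmorphism_cocycF | exact: fmorphism_cobdyF]; do ?[exact: gf | exact: gfB].
Qed.

(** [L] is a maximal subspace of strict elements. An [x] in $F^p$ with no approximation [l] could be
    added to [L], but then [l = x] would be one. *)
Lemma strict_subspace_exists A n : filtered_complex A ->
  exists L : fc_obj A n -> Prop,
    [/\ subspace L,
        forall p x, L x -> fc_F A p (n + 1) (fc_d A n (n + 1) x) -> fc_F A p n x &
        forall p x, fc_F A p n x -> exists l,
          [/\ L l, fc_F A p n l & fc_F A (p + 1) (n + 1) (fc_d A n (n + 1) (x - l))]].
Proof.
move=> HA; have FF := fc_filtration n HA; have [Fs _ _ _] := FF.
have FF1 := fc_filtration (n + 1) HA; have [Fs1 _ _ _] := FF1.
pose d := fc_d A n (n + 1).
pose strict x := forall p, fc_F A p (n + 1) (d x) -> fc_F A p n x.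
have [|x ->|L [Ls _ Lstrict Lmax]] :=
    maximal_subspace_in (good := strict) (S0 := fun x => x = 0).
- exact: subspace_zero.
- by move=> p _; apply: subspace0.
exists L; split=> // [p x /Lstrict|p x Fx]; first exact.
apply: contrapT => nl.
have Lx : L x.
  apply: Lmax => a l Ll q Fd; have [a0|a0] := eqVneq a 0.
    by move: Fd; rewrite a0 scale0r add0r; apply: Lstrict.
  have Fdax r : r <= p -> fc_F A r (n + 1) (d (a *: x)).
    by move=> le_rp; apply: fc_F_d => //; apply: subspaceZ => //;
      apply: (filtration_le FF le_rp Fx).
  have Fl r : r <= p -> fc_F A r (n + 1) (d (a *: x + l)) -> fc_F A r n l.
    move=> le_rp; rewrite linearD => Fr; apply: Lstrict => //.
    exact: subspace_addKl (Fs1 r) (Fdax r le_rp) Fr.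
  have [le_qp|lt_pq] := leP q p.
    apply: subspaceD => //; last exact: Fl.
    by apply: subspaceZ => //; apply: (filtration_le FF le_qp Fx).
  (* Here [p < q], so $d(ax + l)$ lies in $F^{p+1}$ and $-a^{-1}l$ is the approximation of [x]
     assumed not to exist. *)
  case: nl; exists (- a^-1 *: l); split; first exact: subspaceZ.
    apply: subspaceZ => //; apply: Fl => //.
    by apply: (filtration_le FF1 _ Fd); lia.
  have -> : x - (- a^-1 *: l) = a^-1 *: (a *: x + l).
    by rewrite scaleNr opprK scalerDr scalerA mulVf // scale1r.
  rewrite linearZ; apply: subspaceZ => //.
  by apply: (filtration_le FF1 _ Fd); lia.
apply: nl; exists x; split=> //.
by rewrite subrr linear0; apply: subspace0.
Qed.

(** [h] takes values in [L], kills [L] and inverts [d] on [L], which gives $hh = 0$ and $hdh = h$.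
    The last property restates the approximation by elements of [L]. *)
Lemma contraction_exists A : filtered_complex A ->
  exists h : forall n m, {linear fc_obj A n -> fc_obj A m},
  [/\ forall n m x, m != n - 1 -> h n m x = 0,
      forall p n m x, fc_F A p n x -> fc_F A p m (h n m x),
      forall n m k x, h m k (h n m x) = 0,
      forall n m x, m = n - 1 -> h n m (fc_d A m n (h n m x)) = h n m x &
      forall p n x, fc_F A p n x -> exists l,
        [/\ fc_F A p n l, h (n + 1) n (fc_d A n (n + 1) l) = l &
            fc_F A (p + 1) (n + 1) (fc_d A n (n + 1) (x - l))]].
Proof.
move=> HA; have FF n := fc_filtration n HA.
have Fs p n : subspace (fc_F A p n) by case: (FF n).
have [L LP] := all_sig (fun n => cid (strict_subspace_exists n HA)).
have Ls n : subspace (L n) by case: (LP n).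
have Lstrict p n m x : m = n + 1 -> L n x -> fc_F A p m (fc_d A n m x) -> fc_F A p n x.
  by move=> ->; case: (LP n) => _ strictL _; apply: strictL.
have hex n m : exists u : {linear fc_obj A n -> fc_obj A m},
    [/\ forall x, m != n - 1 -> u x = 0,
        forall x, L m (u x), forall p x, fc_F A p n x -> fc_F A p m (u x),
        forall x, L n x -> u x = 0 &
        m = n - 1 -> forall l, L m l -> u (fc_d A m n l) = l].
  have [mE|mE] := eqVneq m (n - 1); last first.
    exists \0; split=> // *; [exact: subspace0 | exact: subspace0 |].
    by move/eqP: mE.
  have nE : n = m + 1 by lia.
  pose R (z : fc_obj A n * fc_obj A m) := L m z.2 /\ L n (z.1 - fc_d A m n z.2).
  have Rs : subspace R.
    split; first split; first exact: (Ls m).1.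
      suff: L n (0 - fc_d A m n 0) by [].
      by rewrite linear0 subr0; apply: subspace0.
    move=> a [x y] [x' y'] [/= Ly Lx] [/= Ly' Lx']; split; first exact: (Ls m).2.
    rewrite /= linearP opprD addrACA -scalerN -scalerDr.
    exact: (Ls n).2.
  have [|u [uR uL uF]] := filtered_extension (FF n) (FF m) (Ls m) Rs.
    (* With $x = l + dy$ in $F^q$, also $dl = dx$ is in $F^q$. Strictness gives [l] in $F^q$, hence
       $dy$, and strictness again gives [y]. *)
    move=> x y [/= Ly Lx]; split=> // q Fx.
    apply: (Lstrict q m n) => //.
    rewrite -[fc_d A m n y](subKr x); apply: subspaceB => //.
    apply: (Lstrict q n (n + 1)) => //.
    by rewrite linearB fc_dd // subr0; apply: fc_F_d.
  exists u; split=> // [x Lx|_ l Ll].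
    apply: uR; split; first exact: (Ls m).1.
    suff: L n (x - fc_d A m n 0) by [].
    by rewrite linear0 subr0.
  by apply: uR; split; rewrite /= ?subrr //; apply: (Ls n).1.
have [h hP] := all_sig (fun n => all_sig (fun m => cid (hex n m))); exists h.
split=> [n m x|p n m x|n m k x|n m x mE|p n x Fx].
- by have [h0 _ _ _ _] := hP n m; apply: h0.
- by have [_ _ hF _ _] := hP n m; apply: hF.
- by have [_ hL _ _ _] := hP n m; have [_ _ _ h0 _] := hP m k; apply: h0.
- by have [_ hL _ _ hd] := hP n m; apply: hd.
- have [_ _ /(_ p x Fx) [l [Ll Fl Fd]]] := LP n; exists l; split=> //.
  by have [_ _ _ _ hd] := hP (n + 1) n; apply: hd => //; lia.
Qed.

End FilteredComplexes.

(** * The idempotent [phi], its kernel and the first page *)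

Section Splitting.
Variables (K : fieldType) (A : fcdata K).
Variable h : forall n m, {linear fc_obj A n -> fc_obj A m}.
Hypothesis HA : filtered_complex A.
Hypothesis h_F : forall p n m x, fc_F A p n x -> fc_F A p m (h n m x).
Hypothesis hh : forall n m k x, h m k (h n m x) = 0.
Hypothesis hdh : forall n m x, m = n - 1 -> h n m (fc_d A m n (h n m x)) = h n m x.
Hypothesis h_deep : forall p n x, fc_F A p n x -> exists l,
  [/\ fc_F A p n l, h (n + 1) n (fc_d A n (n + 1) l) = l &
      fc_F A (p + 1) (n + 1) (fc_d A n (n + 1) (x - l))].

Let Fs p n : subspace (fc_F A p n).
Proof. by case: HA => _ [_ []]. Qed.

Definition phi n : {linear fc_obj A n -> fc_obj A n} :=
  (h (n + 1) n \o fc_d A n (n + 1)) \+ (fc_d A (n - 1) n \o h n (n - 1)).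

Arguments phi : simpl never.

(** The projection onto the kernel of [phi], once [phi] is known to be idempotent; it becomes [f],
    and the inclusion of the kernel becomes [g]. *)
Definition ret n : {linear fc_obj A n -> fc_obj A n} := idfun \- phi n.

Arguments ret : simpl never.

Definition kerphi n (x : fc_obj A n) : Prop := phi n x = 0.

(** The neighbouring degrees are variables because, for instance, [n + 1 - 1] is only provably equal
    to [n]. *)
Lemma phiE n m k x : m = n + 1 -> k = n - 1 ->
  phi n x = h m n (fc_d A n m x) + fc_d A k n (h n k x).
Proof. by move=> -> ->. Qed.

Lemma retE n x : ret n x = x - phi n x.
Proof. by []. Qed.

(** Both sides equal $dhdx$, since $dd = 0$. *)
Lemma phi_d n m x : m = n + 1 -> phi m (fc_d A n m x) = fc_d A n m (phi n x).
Proof.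
move=> mE; have nE : n = m - 1 by lia.
rewrite (@phiE m (m + 1) n) // (@phiE n m (n - 1)) // fc_dd // linear0 add0r.
by rewrite linearD /= fc_dd // addr0.
Qed.

Lemma phi_F p n x : fc_F A p n x -> fc_F A p n (phi n x).
Proof. by move=> Fx; apply: subspaceD => //; do ?[apply: h_F | apply: fc_F_d]. Qed.

(** [phi] fixes each of its summands $hdx$ and $dhx$, by $hh = 0$, $dd = 0$ and $hdh = h$. *)
Lemma phiK n x : phi n (phi n x) = phi n x.
Proof.
have phi_h : phi n (h (n + 1) n (fc_d A n (n + 1) x)) = h (n + 1) n (fc_d A n (n + 1) x).
  by rewrite (@phiE n (n + 1) (n - 1)) // hh linear0 addr0 hdh //; lia.
have phi_dh : phi n (fc_d A (n - 1) n (h n (n - 1) x)) = fc_d A (n - 1) n (h n (n - 1) x).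
  by rewrite (@phiE n (n + 1) (n - 1)) // fc_dd // linear0 add0r hdh.
rewrite [phi n x in LHS](@phiE n (n + 1) (n - 1)) // linearD.
exact: congr2 phi_h phi_dh.
Qed.

Lemma ret_F p n x : fc_F A p n x -> fc_F A p n (ret n x).
Proof. by move=> Fx; rewrite retE; apply: subspaceB => //; apply: phi_F. Qed.

Lemma ret_d n m x : m = n + 1 -> ret m (fc_d A n m x) = fc_d A n m (ret n x).
Proof. by move=> mE; rewrite !retE linearB phi_d. Qed.

Lemma kerphi_subspace n : subspace (@kerphi n).
Proof.
rewrite /kerphi; split=> [|a x y x0 y0]; first exact: linear0.
by rewrite linearP x0 y0 scaler0 addr0.
Qed.

Lemma ret_kerphi n x : kerphi (ret n x).
Proof. by rewrite /kerphi retE linearB phiK subrr. Qed.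

Lemma ret_id n x : kerphi x -> ret n x = x.
Proof. by rewrite /kerphi retE => ->; rewrite subr0. Qed.

Lemma kerphi_d n m x : kerphi x -> kerphi (fc_d A n m x).
Proof.
rewrite /kerphi => x0; have [mE|mE] := eqVneq m (n + 1).
  by rewrite phi_d // x0 linear0.
by rewrite fc_d_eq0 // linear0.
Qed.

(* Applying [h] to [h d x + d h x = 0] kills the first term. *)
Lemma kerphi_hd n x : kerphi x -> h (n + 1) n (fc_d A n (n + 1) x) = 0.
Proof.
rewrite /kerphi (@phiE n (n + 1) (n - 1)) // => x0.
have hx : h n (n - 1) x = 0.
  by have /(congr1 (h n (n - 1))) := x0; rewrite linearD /= hh add0r hdh // linear0.
by move: x0; rewrite hx linear0 addr0.
Qed.

(** The approximation [l] of [x] lies in $F^{p+1}$, because $hdx = 0$ and $hdl = l$; thus both terms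
    of $dx = d(x - l) + dl$ lie in $F^{p+1}$. *)
Lemma kerphi_d_F p n m x : m = n + 1 ->
  kerphi x -> fc_F A p n x -> fc_F A (p + 1) m (fc_d A n m x).
Proof.
move=> -> x0 Fx; have [l [Fl hdl Fd]] := h_deep Fx.
have := h_F n Fd; rewrite !linearB /= hdl kerphi_hd // sub0r => Fl1.
have {}Fl1 : fc_F A (p + 1) n l by rewrite -[l]opprK; apply: subspaceN.
by rewrite -(subrK l x) linearD; apply: subspaceD => //; apply: fc_F_d.
Qed.

(** This makes [ret] well defined from $E_1$ to the graded pieces of the kernel: a boundary $dz$
    goes to $d$ of an element of the kernel, and there [d] raises the filtration. *)
Lemma E1B_span_F p n x : Defs.span (E1B K A p n) x -> fc_F A (p + 1) n (ret n x).
Proof.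
move=> sx; apply: (sx (fun x => fc_F A (p + 1) n (ret n x))).
  split=> [|a y z Fy Fz]; first by rewrite linear0; apply: subspace0.
  by rewrite linearP; apply: (Fs (p + 1) n).2.
move=> y [Fy|[z [Fz ->]]]; first exact: ret_F.
rewrite ret_d; last by lia.
by apply: kerphi_d_F; [lia | apply: ret_kerphi | apply: ret_F].
Qed.

(** Thus [x] and [ret n x] have the same class in $E_1$: $hdx$ is in $F^{p+1}$ because $dx$ is, and
    $dhx$ is a boundary from $F^p$. *)
Lemma phi_E1B p n x : E1Z K A p n x -> Defs.span (E1B K A p n) (phi n x).
Proof.
move=> [Fx Fdx]; rewrite (@phiE n (n + 1) (n - 1)) //.
apply: (subspaceD (span_subspace _)) => T _; apply; first by left; apply: h_F.
by right; exists (h n (n - 1) x); split=> //; apply: h_F.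
Qed.

Lemma E1Z_subspace p n : subspace (E1Z K A p n).
Proof.
split=> [|a x y [Fx Fdx] [Fy Fdy]].
  by split; rewrite ?linear0; apply: subspace0.
by split; rewrite ?linearP; [apply: (Fs p n).2 | apply: (Fs (p + 1) (n + 1)).2].
Qed.

Lemma kerphi_E1Z p n x : kerphi x -> fc_F A p n x -> E1Z K A p n x.
Proof. by move=> x0 Fx; split=> //; apply: kerphi_d_F. Qed.

(* [k] is [p + (n - p)], which is not convertible to [n]. *)
Lemma E1_section p n k : k = n ->
  exists u : {linear quot (E1Z K A p k) (E1B K A p k) -> cyc (@kerphi n)},
    [/\ forall c, fc_F A p n (val (u c)),
        forall c, fc_F A (p + 1) n (val (u c)) -> c = 0 &
        forall x : cyc (@kerphi n), fc_F A p n (val x) ->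
          exists c, fc_F A (p + 1) n (val (x - u c))].
Proof.
move=> ->; have Zs := E1Z_subspace p n; have Ks := @kerphi_subspace n.
pose Q := quot (E1Z K A p n) (E1B K A p n).
(* [G] relates a class to its representatives in $F^p$ of the kernel. They are determined only
   modulo $F^{p+1}$, so a linear choice among them is required. *)
pose G (w : Q * fc_obj A n) := [/\ kerphi w.2, fc_F A p n w.2 &
  exists2 z : cyc (E1Z K A p n), w.1 = (\pi_Q z)%qT & val z = w.2].
have Gs : subspace G.
  split.
    split; [exact: Ks.1 | exact: (Fs p n).1 |].
    by exists 0 => //; rewrite pi_quot0.
  move=> a [c x] [c' x'] [/= kx Fx [z zE zx]] [/= kx' Fx' [z' zE' zx']].
  split; [exact: Ks.2 | exact: (Fs p n).2 |].
  exists (a *: z + z'); last by rewrite linearP /= zx zx'.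
  by rewrite pi_quot_linear -zE -zE'.
have [|u uG] := linear_section Gs.
  move=> c; have [z ->] := quotP c; have [Fz Fdz] := cycP z Zs.
  have kr := ret_kerphi (val z); have Fr := ret_F Fz.
  have [w wE] := cyc_of Zs (kerphi_E1Z kr Fr).
  exists (ret n (val z)); split=> //; exists w => //=.
  by apply/eq_quotP; rewrite wE retE subKr; apply: phi_E1B.
have [|v vE] := corestrict_linear (u := u) Ks; first by move=> c; case: (uG c).
exists v; split=> [c|c|x Fx]; rewrite ?vE; first by case: (uG c).
  have [_ _ [z /= -> <-] Fz] := uG c.
  by rewrite -pi_quot0; apply/eq_quotP; rewrite subr0 => T _; apply; left.
have kx := cycP x Ks; have [z zE] := cyc_of Zs (kerphi_E1Z kx Fx).
exists (\pi_Q z)%qT; rewrite linearB /= vE.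
have [/= ku _ [w /eq_quotP zw /= wE]] := uG (\pi_Q z)%qT.
by rewrite -(ret_id (subspaceB Ks kx ku)) -zE -wE; apply: E1B_span_F.
Qed.

End Splitting.

(** * Assembly of the homotopy transfer diagram *)

Unset Implicit Arguments.

Theorem theorem2p7 (K : fieldType) (A : fcdata K) :
  filtered_complex A ->
  exists (M : fcdata K)
         (f : forall n, {linear fc_obj A n -> fc_obj M n})
         (g : forall n, {linear fc_obj M n -> fc_obj A n})
         (h : forall n m, {linear fc_obj A n -> fc_obj A m}),
    filtered_complex M /\
    fmorphism f /\ fmorphism g /\
    fhomotopy h (fun n x => x) (fun n x => g n (f n x)) /\
    (forall p n, iso_dsum (fc_F M p n) p (fun q => E1 A q (n - q))) /\
    (forall p n x, fc_F M p n x -> fc_F M (p + 1) (n + 1) (fc_d M n (n + 1) x)) /\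
    filtered_qiso f /\
    filtered_qiso g.
Proof.
move=> HA; have [h [h_deg h_F hh hdh h_deep]] := contraction_exists HA.
have Ks n : subspace (@kerphi K A h n) by apply: kerphi_subspace.
have [r rE] := all_sig (fun n => cid (corestrict_linear (Ks n)
  (ret_kerphi HA hh hdh (n := n)))).
have dex n m : exists v : {linear cyc (@kerphi K A h n) -> cyc (@kerphi K A h m)},
    forall x, val (v x) = fc_d A n m (val x).
  apply: (corestrict_linear (u := fc_d A n m \o val) (Ks m)) => x.
  by apply: kerphi_d => //; apply: cycP.
have [d dE] := all_sig (fun n => all_sig (fun m => cid (dex n m))).
(* [M] is the kernel of [phi] with the induced differential and filtration. *)
pose M := FCData d (fun p n x => fc_F A p n (val x)).
pose f n : {linear fc_obj A n -> fc_obj M n} := r n.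
pose g n : {linear fc_obj M n -> fc_obj A n} := val.
have HM : filtered_complex M.
  have [d0 [dd [Fs [Fdec [Fd [Fex Fbd]]]]]] := HA.
  split=> [n m x mE|]; first by apply: val_inj; rewrite dE d0 // linear0.
  split=> [n x|]; first by apply: val_inj; rewrite !dE dd linear0.
  split=> [p n|].
    split=> [|a x y Fx Fy]; first exact: (Fs p n).1.
    exact: (Fs p n).2 a _ _ Fx Fy.
  split=> [p n x|]; first exact: Fdec.
  split=> [p n x Fx|]; first by rewrite /= dE; apply: Fd.
  split=> [n x|n]; first exact: Fex.
  by have [p Fp] := Fbd n; exists p => x /Fp x0; apply: val_inj; rewrite x0 linear0.
have ff : fmorphism f.
  split=> [n x|p n x Fx] /=; last by rewrite rE; apply: ret_F.
  by apply: val_inj; rewrite dE !rE ret_d.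
have fg : fmorphism g by split=> [n x|//]; rewrite /g /= dE.
have gfh : fhomotopy h (fun n x => x) (fun n x => g n (f n x)).
  split=> // [p n x|n x]; first exact: h_F.
  (* $1 - gf = 1 - (1 - \phi) = \phi$, which is $hd + dh$ by definition. *)
  by rewrite /g /= rE retE subKr.
have fgK n y : f n (g n y) = y.
  by apply: val_inj; rewrite rE ret_id //; apply: cycP.
exists M, f, g, h; split=> //; split=> //; split=> //; split=> //.
split.
  (* $E_1^{q,n-q}$ lives in degree [q + (n - q)], which is only provably [n]; [iota q] identifies it
     with $F^qM^n/F^{q+1}M^n$. *)
  move=> p n; have kE q : q + (n - q) = n by lia.
  have [iota iotaP] := all_sig (fun q => cid (E1_section HA h_F hh hdh h_deep q (kE q))).
  apply: (iso_dsum_filtration (F := fun p => fc_F M p n) (iota := iota)).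
  - exact: fc_filtration.
  - by move=> q e; have [iF _ _] := iotaP q; apply: iF.
  - by move=> q e Fe; have [_ iI _] := iotaP q; apply: (iI e Fe).
  - by move=> q x Fx; have [_ _ iS] := iotaP q; apply: (iS x Fx).
split; last exact: filtered_qiso_of_retract gfh fgK.
by move=> p n x Fx; rewrite /= dE; apply: (kerphi_d_F (h := h)) => //; apply: (cycP x (Ks n)).
Qed.
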